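(* Annotated Cluster Modification admits an algorithm running in time $2^{\ell}\cdot n^{\mathcal{O}(1)}$, where $\ell$ is the integer of which $X$ and $X'$ are partitions and $n=|V(G)|$.
   Context: A cluster graph is a graph in which every connected component is a clique. A partition of a positive integer $\ell$ is a multiset of positive integers summing to $\ell$. For multisets, $A\cup B$ is the additive union (multiplicities add) and $A\setminus B$ has multiplicity $\max\{0,\mathrm{mul}(x,A)-\mathrm{mul}(x,B)\}$ for each $x$. For a graph $G$, $\mathrm{CS}(G)$ is the multiset of the sizes (numbers of vertices) of its connected components. For a cluster graph $G$, a partition $X'=\{x'_1,\dots,x'_s\}$ of $\ell$ is $G$-valid if $G$ has $s$ distinct components $H_1,\dots,H_s$ with $|V(H_i)|=x'_i$. For partitions $X,X'$ of $\ell$ with $X'$ $G$-valid, a modification of $G$ with respect to $(X,X')$ is a cluster graph $\hat G$ obtained from $G$ by adding edges (i.e., merging components) such that $\mathrm{CS}(\hat G)=(\mathrm{CS}(G)\setminus X')\cup X$. Annotated Cluster Modification: given a cluster graph $G$, a non-negative integer $k$, and two partitions $X,X'$ of an integer $\ell\in\mathbb{N}$ with $X'$ $G$-valid, decide whether there is a modification $\hat G$ of $G$ with respect to $(X,X')$ with $|E(\hat G)\setminus E(G)|\le k$. *)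

(* Defs.v *)
From mathcomp Require Import all_boot finmap multiset.

Set Implicit Arguments.
Unset Strict Implicit.
Unset Printing Implicit Defensive.

Local Open Scope nat_scope.

Section Graphs.

Variable T : finType.
Implicit Types (e eh : rel T) (H : {set T}) (X : {mset nat}%mset).

Definition simple_graph e := symmetric e /\ irreflexive e.

Definition edges e : {set {set T}} :=
  [set A | [exists x, exists y, e x y && (A == [set x; y])]].

Definition components e : {set {set T}} :=
  equivalence_partition (connect e) [set: T].

Definition clique e H := {in H &, forall x y, x != y -> e x y}.

Definition cluster_graph e :=
  simple_graph e /\ {in components e, forall H, clique e H}.

Definition CS e : {mset nat}%mset :=
  seq_mset [seq #|(H : {set T})| | H <- enum (components e)].

Definition is_partition (l : nat) X :=
  [/\ 0 < l, 0 \notin X & \sum_(x <- X) x = l].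

Definition graph_valid e X' :=
  exists Hs : seq {set T},
    [/\ uniq Hs, {subset Hs <= components e} &
        seq_mset [seq #|H| | H : {set T} <- Hs] = X'].

Definition modification e X X' eh :=
  [/\ cluster_graph eh, subrel e eh & CS eh = ((CS e `\` X') `+` X)%mset].

Definition acm_instance e (l : nat) X X' :=
  [/\ cluster_graph e, is_partition l X, is_partition l X' & graph_valid e X'].

Definition acm_yes e (k : nat) X X' :=
  exists eh, modification e X X' eh /\ #|edges eh :\: edges e| <= k.

End Graphs.

(** A word RAM with [w]-bit words.  A program uses finitely many
    registers, and a memory addressed by words.  Every instruction and every test
    takes one time unit; addition wraps around modulo [2 ^ w] and there is no
    multiplication, so no step handles more than [w] bits at once. *)

Record state := State { reg : nat -> nat; mem : nat -> nat }.

Definition upd (f : nat -> nat) (i v : nat) : nat -> nat :=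
  fun j => if j == i then v else f j.

Inductive cmd : Type :=
| Skip
| Const (r v : nat)
| Move (r a : nat)
| Add (r a b : nat)
| Sub (r a b : nat)
| Read (r a : nat)
| Write (a r : nat)
| Seq (p q : cmd)
| If (r : nat) (p q : cmd)
| While (r : nat) (p : cmd).

(** [exec w p s t s']: on [w]-bit words, program [p] started in state [s]
    halts in state [s'] after exactly [t] time units. *)
Inductive exec (w : nat) : cmd -> state -> nat -> state -> Prop :=
| ExecSkip s : exec w Skip s 1 s
| ExecConst r v s :
    exec w (Const r v) s 1 (State (upd (reg s) r (v %% 2 ^ w)) (mem s))
| ExecMove r a s :
    exec w (Move r a) s 1 (State (upd (reg s) r (reg s a)) (mem s))
| ExecAdd r a b s :
    exec w (Add r a b) s 1
      (State (upd (reg s) r ((reg s a + reg s b) %% 2 ^ w)) (mem s))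
| ExecSub r a b s :
    exec w (Sub r a b) s 1 (State (upd (reg s) r (reg s a - reg s b)) (mem s))
| ExecRead r a s :
    exec w (Read r a) s 1 (State (upd (reg s) r (mem s (reg s a))) (mem s))
| ExecWrite a r s :
    exec w (Write a r) s 1 (State (reg s) (upd (mem s) (reg s a) (reg s r)))
| ExecSeq p q s1 t1 s2 t2 s3 :
    exec w p s1 t1 s2 -> exec w q s2 t2 s3 -> exec w (Seq p q) s1 (t1 + t2) s3
| ExecIfT r p q s t s' :
    reg s r != 0 -> exec w p s t s' -> exec w (If r p q) s t.+1 s'
| ExecIfF r p q s t s' :
    reg s r = 0 -> exec w q s t s' -> exec w (If r p q) s t.+1 s'
| ExecWhileT r p s1 t1 s2 t2 s3 :
    reg s1 r != 0 -> exec w p s1 t1 s2 -> exec w (While r p) s2 t2 s3 ->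
    exec w (While r p) s1 (t1 + t2).+1 s3
| ExecWhileF r p s :
    reg s r = 0 -> exec w (While r p) s 1 s.

Lemma exec_det w p s t1 s1 t2 s2 :
  exec w p s t1 s1 -> exec w p s t2 s2 -> t1 = t2 /\ s1 = s2.
Proof.
move=> H1; elim: H1 t2 s2 => {p s t1 s1};
  intros; match goal with H : exec _ _ _ ?t ?s |- _ = ?t /\ _ = ?s =>
    inversion H; subst; clear H end;
  repeat match goal with
  | H : is_true (reg ?s ?r != 0), H' : reg ?s ?r = 0 |- _ =>
      by rewrite H' in H
  | IH : forall t s, exec _ ?p ?s0 t s -> _, H : exec _ ?p ?s0 _ _ |- _ =>
      case: (IH _ _ H) => ? ?; subst; clear IH
  end; by [].
Qed.

Definition init (input : seq nat) : state := State (fun _ => 0) (nth 0 input).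

(** The graph is given by its adjacency matrix, row by row; [xs] and [xs'] are
    listings, in arbitrary order, of the two partitions. *)
Definition encode (n : nat) (e : rel 'I_n) (k : nat) (xs xs' : seq nat) : seq nat :=
  [:: n; k; size xs; size xs'] ++ xs ++ xs' ++
  [seq (e i j : nat) | i <- enum 'I_n, j <- enum 'I_n].

Definition fits (w : nat) (input : seq nat) := all (fun v => v < 2 ^ w) input.

Definition accepts (s : state) := reg s 0 != 0.

(* Main.v *)
Require Import Defs.
From mathcomp Require Import all_boot finmap multiset zify.

Set Implicit Arguments.
Unset Strict Implicit.
Unset Printing Implicit Defensive.

(** The number of edges of a cluster graph is the sum of ['C(x, 2)] over its
    component sizes, so every modification has the same cost, the difference of
    these sums over [X] and [X'].  The cluster supergraphs of [G] realise exactly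
    the multisets refined by [CS G]; as common parts cancel in a refinement, a
    modification exists iff the parts of [X'] can be grouped into sums equal to
    the parts of [X].  Listing [X] as [xs], this means that some composition of
    [l] which has a cut at every partial sum of [xs] has the parts [X'].  The
    program runs through the [2 ^ l] bit strings describing the cuts, and compares
    for each [v <= l] the multiplicities of [v]; it never writes to memory nor
    reads the graph. *)

(** * Refinement of multisets of integers *)

(** A group may be empty and then realises a part 0 of [B], which is why [refines_comp_sizes] keeps
    0 out of the target. *)
Definition refines (A B : seq nat) :=
  exists2 zs : seq (seq nat), perm_eq (flatten zs) A & perm_eq (map sumn zs) B.

(** Lets one reorder the groups or components themselves when only the list of their sums or sizes
    is known up to order. *)
Lemma perm_map_inv (T U : eqType) (f : T -> U) (s : seq T) (t : seq U) :
  perm_eq (map f s) t -> exists2 s', perm_eq s s' & map f s' = t.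
Proof.
elim: t s => [|y t IH] s st.
  by exists [::]; rewrite // [s]size0nil // -(size_map f) (perm_size st).
have /mapP[x xs Ey]: y \in map f s by rewrite (perm_mem st) mem_head.
have xr := perm_to_rem xs.
have : perm_eq (map f (rem x s)) t.
  rewrite -(perm_cons y) -(permPr st) perm_sym Ey -map_cons; exact: perm_map.
case/IH=> s' rs' Et; exists (x :: s'); last by rewrite /= Et Ey.
by rewrite (permPl xr) perm_cons.
Qed.

Lemma refines_perml A A' B : perm_eq A A' -> refines A B -> refines A' B.
Proof. by move=> p [zs zA zB]; exists zs; rewrite // (permPl zA). Qed.

Lemma refines_permr A B B' : perm_eq B B' -> refines A B -> refines A B'.
Proof. by move=> p [zs zA zB]; exists zs; rewrite // (permPl zB). Qed.

Lemma refines_cat R A B : refines A B -> refines (R ++ A) (R ++ B).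
Proof.
case=> zs zA zB; exists ([seq [:: x] | x <- R] ++ zs).
  by rewrite flatten_cat flatten_seq1 perm_cat2l.
rewrite map_cat -map_comp (@eq_map _ _ _ id) ?map_id ?perm_cat2l //.
by move=> x /=; rewrite addn0.
Qed.

(* The group summing to the target [a] replaces the source [a] in whatever
   group uses it. *)
Lemma refines_cons_cancel a A B :
  0 \notin A -> refines (a :: A) (a :: B) -> refines A B.
Proof.
move=> A0 [zs zA zB].
have [/= [|z ys] zy E] := perm_map_inv zB; first by [].
case: E => Ea EB.
have zyA : perm_eq (z ++ flatten ys) (a :: A).
  by rewrite -(permPr zA) perm_sym (perm_flatten zy).
have /orP[az|/flattenP[z2 z2ys az2]] : (a \in z) || (a \in flatten ys).
  by rewrite -mem_cat (perm_mem zyA) mem_head.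
- have pz := perm_to_rem az.
  have rA : perm_eq (rem a z ++ flatten ys) A.
    by rewrite -(perm_cons a) -(permPr zyA) -cat_cons perm_cat2r perm_sym.
  have r0 : rem a z = [::].
    have := perm_sumn pz; rewrite Ea /= => r0.
    case Er: (rem a z) => [//|y r]; exfalso.
    have y0 : y = 0 by move: r0; rewrite Er /=; lia.
    by move/negP: A0; apply; rewrite -(perm_mem rA) Er y0 mem_head.
  by rewrite r0 in rA; exists ys; rewrite // EB.
- have pz2 := perm_to_rem az2; have pys := perm_to_rem z2ys.
  exists ((z ++ rem a z2) :: rem z2 ys).
    rewrite -(perm_cons a) -(permPr zyA) /= -catA.
    rewrite perm_sym (permPl (_ : perm_eq _ (z ++ a :: rem a z2 ++ flatten (rem z2 ys)))).
      by rewrite -cat1s perm_catCA.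
    rewrite perm_cat2l -cat_cons.
    by rewrite (permPl (perm_flatten pys)) -[flatten (_ :: _)]/(_ ++ _) perm_cat2r.
  rewrite /= sumn_cat -EB perm_sym (permPl (perm_map sumn pys)) /=.
  by have := perm_sumn pz2; rewrite /= Ea => ->.
Qed.

Lemma refines_cat_cancel R A B :
  0 \notin R ++ A -> refines (R ++ A) (R ++ B) -> refines A B.
Proof.
elim: R => [//|a R IH] /=; rewrite inE negb_or => /andP[_ RA0].
by move/(refines_cons_cancel RA0); exact: IH.
Qed.

(** * Component sizes of cluster graphs *)

Lemma perm_flatten_fibers (T U : eqType) (f : T -> U) (s : seq T) (t : seq U) :
  uniq t -> {in s, forall x, f x \in t} ->
  perm_eq (flatten [seq [seq x <- s | f x == y] | y <- t]) s.
Proof.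
elim: t s => [|y t IH] s /=; first by case: s => // x s _ /(_ x (mem_head _ _)).
case/andP=> yt ut st; rewrite perm_sym.
rewrite -(permPl (permEl (perm_filterC [pred x | f x == y] s))) perm_cat2l perm_sym.
have E : [seq [seq x <- [seq x <- s | f x != y] | f x == y'] | y' <- t] =
    [seq [seq x <- s | f x == y'] | y' <- t].
  apply/eq_in_map => y' y't; rewrite -filter_predI; apply: eq_filter => x /=.
  by case: eqP => //= ->; apply: contraNneq yt => <-.
have := IH [seq x <- s | f x != y] ut; rewrite E.
apply=> x; rewrite mem_filter => /andP[fy /st].
by rewrite inE (negPf fy).
Qed.

Lemma perm_eq_refl (T : eqType) (s t : seq T) : s = t -> perm_eq s t.
Proof. by move->. Qed.

Lemma flatten_uniq_mem (T : eqType) (ss : seq (seq T)) s s' x :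
  uniq (flatten ss) -> s \in ss -> s' \in ss -> x \in s -> x \in s' -> s = s'.
Proof.
elim: ss => //= r ss IH; rewrite cat_uniq => /and3P[_ /hasPn dis u].
have out t : t \in ss -> x \in t -> x \in r -> False.
  move=> tss xt xr; have /dis/negP : x \in flatten ss by apply/flattenP; exists t.
  by [].
rewrite !inE => /orP[/eqP->|sss] /orP[/eqP->|s'ss] xs xs' //; last exact: IH.
  by case: (out _ s'ss xs' xs).
by case: (out _ sss xs xs').
Qed.

(** Empty lists are excluded because they could repeat without leaving a trace in the flattening. *)
Lemma flatten_uniq (T : eqType) (ss : seq (seq T)) :
  uniq (flatten ss) -> [::] \notin ss -> uniq ss.
Proof.
elim: ss => //= s ss IH; rewrite inE negb_or cat_uniq.
case/and3P=> _ /hasPn dis u /andP[s0 ss0]; rewrite IH // andbT.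
apply/negP=> sss; case: s s0 dis sss => // x s _ dis sss.
have /dis : x \in flatten ss by apply/flattenP; exists (x :: s); rewrite ?mem_head.
by rewrite mem_head.
Qed.

Section ClusterGraphs.

Variable T : finType.
Implicit Types (e eh : rel T) (H K : {set T}).

Definition comp_sizes e := [seq #|(H : {set T})| | H <- enum (components e)].

Lemma connect_equivalence e : simple_graph e ->
  {in [set: T] & &, equivalence_rel (connect e)}.
Proof.
move=> [se _]; have sc := sym_connect_sym se.
move=> x y z _ _ _; split; first exact: connect0.
by move=> xy; exact: (same_connect sc).
Qed.

Lemma components_partition e : simple_graph e -> partition (components e) [set: T].
Proof. move=> se; exact: equivalence_partitionP (connect_equivalence se). Qed.

Lemma mem_pblock_components e x y : simple_graph e ->
  (y \in pblock (components e) x) = connect e x y.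
Proof.
move=> se; exact: (pblock_equivalence_partition (connect_equivalence se)).
Qed.

Lemma mem_component e x : simple_graph e -> x \in pblock (components e) x.
Proof. by move=> se; rewrite mem_pblock_components. Qed.

Lemma component_pblock e x : simple_graph e ->
  pblock (components e) x \in components e.
Proof.
move=> se; apply: pblock_mem.
by have /and3P[/eqP-> _ _] := components_partition se; rewrite inE.
Qed.

Lemma cluster_adj e x y : cluster_graph e -> e x y = (x != y) && connect e x y.
Proof.
case=> se cl; have [sym irr] := se; apply/idP/andP => [exy|[nxy cxy]].
  by split; [apply: contraTneq exy => ->; rewrite irr | exact: connect1].
apply: (cl (pblock (components e) x)) => //; first exact: component_pblock.
  exact: mem_component.
by rewrite mem_pblock_components.
Qed.

Lemma comp_sizes_gt0 e : simple_graph e -> 0 \notin comp_sizes e.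
Proof.
move=> se; have /and3P[_ _ n0] := components_partition se.
apply/mapP=> -[H]; rewrite mem_enum => Hc /esym/eqP; rewrite cards_eq0 => /eqP H0.
by rewrite -H0 Hc in n0.
Qed.

Lemma sub_component e eh H x : simple_graph e -> simple_graph eh ->
  subrel e eh -> H \in components e -> x \in H ->
  H \subset pblock (components eh) x.
Proof.
move=> se seh sub Hc xH; have /and3P[_ tI _] := components_partition se.
apply/subsetP=> y yH; rewrite mem_pblock_components //.
have : y \in pblock (components e) x by rewrite (def_pblock tI Hc xH).
rewrite mem_pblock_components //; apply: connect_sub => a b /sub; exact: connect1.
Qed.

(** Each component of [eh] is a disjoint union of components of [e]; the sizes of these form its
    group. *)
Lemma comp_sizes_refine e eh : simple_graph e -> simple_graph eh ->
  subrel e eh -> refines (comp_sizes e) (comp_sizes eh).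
Proof.
move=> se seh sub.
have Pe := components_partition se; have Ph := components_partition seh.
have /and3P[/eqP cove tIe n0e] := Pe; have /and3P[/eqP covh tIh n0h] := Ph.
(* The component of [eh] around [H]. The default [set0] is never reached for a component, which is
   nonempty. *)
pose f H := if [pick x in H] is Some x then pblock (components eh) x else set0.
have fP H : H \in components e -> H \subset f H /\ f H \in components eh.
  move=> Hc; rewrite /f; case: pickP => [x xH|H0].
    by split; [exact: (sub_component se seh sub) | exact: component_pblock].
  case/negP: n0e; rewrite (_ : set0 = H) //; apply/setP=> x.
  by rewrite inE; have /= -> := H0 x.
have fE H K : H \in components e -> K \in components eh ->
    (f H == K) = (H \subset K).
  move=> Hc Kc; have [Hf fc] := fP _ Hc; apply/eqP/idP => [<- //|HK].
  have /set0Pn[x xH] : H != set0 by apply: contraNneq n0e => <-.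
  by rewrite -(def_pblock tIh fc (subsetP Hf x xH)) (def_pblock tIh Kc (subsetP HK x xH)).
exists [seq [seq #|(H : {set T})| | H <- enum (components e) & f H == K]
       | K <- enum (components eh)].
  rewrite (_ : [seq _ | K <- _] = map (map (fun H => #|pred_of_set H|))
    [seq [seq H <- enum (components e) | f H == K] | K <- enum (components eh)]).
    rewrite -map_flatten; apply: perm_map; apply: perm_flatten_fibers.
      exact: enum_uniq.
    by move=> H; rewrite !mem_enum => /fP[].
  by rewrite -map_comp; apply: eq_map.
rewrite /comp_sizes -map_comp; apply: perm_eq_refl; apply/eq_in_map => K.
rewrite mem_enum => Kc /=; rewrite sumnE big_map big_filter big_enum_cond /=.
(* This makes the sizes in the group of [K] add up to the size of [K]: a component of [e] that meets
   [K] lies inside [K]. *)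
have PK : partition [set H in components e | H \subset K] K.
  apply/and3P; split.
  - rewrite eqEsubset; apply/andP; split; apply/subsetP=> x.
      by case/bigcupP=> H; rewrite inE => /andP[_ /subsetP]; apply.
    move=> xK; apply/bigcupP; exists (pblock (components e) x); last exact: mem_component.
    rewrite inE component_pblock //= -(def_pblock tIh Kc xK).
    apply: (sub_component se) => //; [exact: component_pblock | exact: mem_component].
  - by apply: trivIsetS tIe; apply/subsetP=> H; rewrite inE => /andP[].
  - by rewrite inE (negPf n0e).
rewrite (card_partition PK); apply: eq_bigl => H; rewrite inE.
by case Hc: (H \in _) => //=; rewrite fE.
Qed.

(** The converse construction: the components in each group are merged into one clique. *)
Lemma refines_comp_sizes e M : simple_graph e -> 0 \notin M ->
  refines (comp_sizes e) M ->
  exists eh, [/\ cluster_graph eh, subrel e eh & perm_eq (comp_sizes eh) M].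
Proof.
move=> se M0 [zs]; rewrite perm_sym => /perm_map_inv[Hs pH EH] zM.
have /and3P[/eqP cove tIe n0e] := components_partition se.
have memH H : (H \in Hs) = (H \in components e) by rewrite -(perm_mem pH) mem_enum.
have uH : uniq Hs by rewrite -(perm_uniq pH) enum_uniq.
(* [Hs] lists the components in the order in which their sizes occur in [flatten zs], so cutting it
   by the shape of [zs] turns groups of sizes into groups of components. *)
pose Ls := reshape (shape zs) Hs.
have szH : size Hs = sumn (shape zs) by rewrite -size_flatten -EH size_map.
have fL : flatten Ls = Hs by rewrite reshapeKr // szH.
have EL : map (map (fun H : {set T} => #|H|)) Ls = zs.
  by rewrite /Ls map_reshape EH flattenK.
(* An empty group would contribute the sum 0 to [M]. *)
have L0 : [::] \notin Ls.
  apply: contra M0 => L0; rewrite -(perm_mem zM) -EL -map_comp.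
  by apply/mapP; exists [::].
have uL : uniq Ls by apply: flatten_uniq; rewrite ?fL.
have LH L H : L \in Ls -> H \in L -> H \in components e.
  by move=> LL HL; rewrite -memH -fL; apply/flattenP; exists L.
have ULs : uniq (flatten Ls) by rewrite fL.
(* The group that contains the component of [x]; the search always succeeds, by [gP]. *)
pose g x := nth [::] Ls (find (fun L => pblock (components e) x \in L) Ls).
have gP x : g x \in Ls /\ pblock (components e) x \in g x.
  have hs : has (fun L => pblock (components e) x \in L) Ls.
    have : pblock (components e) x \in flatten Ls.
      by rewrite fL memH component_pblock.
    by case/flattenP=> L LL HL; apply/hasP; exists L.
  by split; [rewrite mem_nth // -has_find | exact: nth_find hs].
have gE x L : L \in Ls -> (g x == L) = (pblock (components e) x \in L).
  move=> LL; have [gL xg] := gP x; apply/eqP/idP => [<- //|xL].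
  exact: (flatten_uniq_mem ULs gL LL xg xL).
pose eh x y := (x != y) && (g x == g y).
(* No edge of [eh] leaves a group, and any two distinct vertices of a group are adjacent. *)
have ceh x y : connect eh x y = (g x == g y).
  apply/idP/eqP => [/connectP[p pp ->]|gxy].
    by elim: p x pp => //= z p IH x /andP[/andP[_ /eqP->]] /IH.
  have [->|nxy] := eqVneq x y; first exact: connect0.
  by apply: connect1; rewrite /eh nxy gxy eqxx.
have seh : simple_graph eh.
  split=> [x y|x]; first by rewrite /eh eq_sym [g x == _]eq_sym.
  by rewrite /eh eqxx.
pose B (L : seq {set T}) := [set x | g x == L].
have compB : components eh = [set B (g x) | x in [set: T]].
  by apply: eq_imset => x; apply/setP=> y; rewrite !inE ceh eq_sym.
exists eh; split.
- split=> // H; rewrite compB => /imsetP[z _ ->] x y; rewrite !inE.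
  by move=> /eqP gx /eqP gy nxy; rewrite /eh nxy gx gy eqxx.
- move=> x y exy; apply/andP; split.
    by apply: contraTneq exy => ->; case: se => _ ->.
  rewrite /g (_ : pblock (components e) x = pblock (components e) y) //.
  by apply/esym/same_pblock => //; rewrite mem_pblock_components // connect1.
(* A group is recovered from any vertex of its union, so [B] is injective on [Ls] and distinct
   groups give distinct components of [eh]. *)
have BnE L : L \in Ls -> exists2 x, x \in B L & g x = L.
  move=> LL; case EqL: L LL L0 => [|H L'] LL L0; first by rewrite LL in L0.
  have Hc : H \in components e by apply: LH LL _; rewrite mem_head.
  have /set0Pn[x xH] : H != set0 by apply: contraNneq n0e => <-.
  have gx : g x == H :: L' by rewrite gE // (def_pblock tIe Hc xH) mem_head.
  by exists x; [rewrite inE | exact/eqP].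
have pB : perm_eq (enum (components eh)) (map B Ls).
  apply: uniq_perm; first exact: enum_uniq.
    rewrite map_inj_in_uniq // => L1 L2 L1L L2L EB.
    have [x xB gx] := BnE _ L1L; rewrite -gx.
    by apply/eqP; move: xB; rewrite EB inE.
  move=> K; rewrite mem_enum compB; apply/imsetP/mapP => [[x _ ->]|[L LL ->]].
    by exists (g x) => //; case: (gP x).
  by have [x _ gx] := BnE _ LL; exists x; rewrite ?gx.
rewrite -(permPr zM) (permPl (perm_map _ pB)) -EL -!map_comp.
apply: perm_eq_refl; apply/eq_in_map => L LL /=.
have uLL : uniq L.
  have : subseq L (flatten Ls).
    elim: (Ls) LL => //= L1 Ls' IH; rewrite inE => /orP[/eqP->|/IH s].
      exact: prefix_subseq.
    exact: subseq_trans s (suffix_subseq _ _).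
  by move/subseq_uniq; apply.
have tIL : trivIset [set:: L].
  by apply: trivIsetS tIe; apply/subsetP=> H; rewrite inE => /(LH _ _ LL).
(* Since the components in [L] are disjoint, the size of their union is the sum of their sizes. *)
have -> : B L = cover [set:: L].
  apply/setP=> x; rewrite inE gE //; apply/idP/bigcupP => [xL|[H]].
    by exists (pblock (components e) x); rewrite ?inE // mem_component.
  by rewrite inE => HL xH; rewrite (def_pblock tIe (LH _ _ LL HL) xH).
move: tIL; rewrite /trivIset => /eqP <-.
rewrite sumnE big_map big_uniq //=; apply: eq_bigl => H; by rewrite inE.
Qed.

Lemma edges_cluster e : cluster_graph e ->
  edges e = [set A : {set T} | (#|A| == 2) && [exists H in components e, A \subset H]].
Proof.
move=> ce; have [se _] := ce; have /and3P[_ tI _] := components_partition se.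
apply/setP=> A; rewrite !inE; apply/existsP/andP.
  case=> x /existsP[y /andP[]]; rewrite cluster_adj // => /andP[nxy cxy] /eqP->.
  rewrite cards2 nxy; split=> //; apply/existsP; exists (pblock (components e) x).
  rewrite component_pblock //=; apply/subsetP=> z; rewrite !inE.
  by case/orP=> /eqP->; rewrite mem_pblock_components // connect0.
case=> /cards2P[x [y [nxy ->]]] /existsP[H /andP[Hc /subsetP sH]].
exists x; apply/existsP; exists y; rewrite eqxx andbT cluster_adj // nxy /=.
rewrite -mem_pblock_components // (def_pblock tI Hc) ?sH ?inE ?eqxx ?orbT //.
Qed.

(** Double counting of pairs of a component and a 2-subset of it: by disjointness, each edge lies in
    exactly one component. *)
Lemma card_edges_cluster e : cluster_graph e ->
  #|edges e| = \sum_(x <- comp_sizes e) 'C(x, 2).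
Proof.
move=> ce; have [se _] := ce; have /and3P[_ tI _] := components_partition se.
rewrite edges_cluster // big_map big_enum /=.
under [RHS]eq_bigr => H _ do rewrite -(cards_draws H 2) -sum1_card.
rewrite (exchange_big_dep (mem [set A : {set T} |
   (#|A| == 2) && [exists H in components e, A \subset H]])) /=; last first.
  move=> H A Hc; rewrite !inE => /andP[AH ->] /=.
  by apply/existsP; exists H; rewrite Hc.
rewrite -sum1_card; apply: eq_bigr => A; rewrite inE => /andP[A2 /existsP[H /andP[Hc AH]]].
rewrite (big_pred1 H) // => K; rewrite !inE A2 andbT; apply/andP/eqP => [[Kc AK]|-> //].
have [x xA] : exists x, x \in A by apply/card_gt0P; rewrite (eqP A2).
by rewrite -(def_pblock tI Kc (subsetP AK x xA)) (def_pblock tI Hc (subsetP AH x xA)).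
Qed.

End ClusterGraphs.

(** * Reduction of the decision problem to refinement *)

Lemma acm_yesP (T : finType) (e : rel T) (k l : nat) (xs xs' : seq nat) :
  acm_instance e l (seq_mset xs) (seq_mset xs') ->
  acm_yes e k (seq_mset xs) (seq_mset xs') <->
  refines xs' xs /\ \sum_(x <- xs) 'C(x, 2) - \sum_(x <- xs') 'C(x, 2) <= k.
Proof.
case=> ce [l0 x0 xl] [_ x0' xl'] [Hs [uH sH /eq_seq_msetP pH]].
have [se _] := ce.
(* The sizes of the components outside the family [Hs] that witnesses validity. They occur both in
   [G] and in every modification, and cancel from the refinement and from the cost. *)
pose R := [seq #|H| | H : {set T} <- enum (components e) & H \notin Hs].
have pR : perm_eq (comp_sizes e) (R ++ xs').
  rewrite perm_sym perm_catC -(permPl (_ : perm_eq ([seq #|H| | H : {set T} <- Hs] ++ R) _)) ?perm_cat2r //.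
  rewrite -map_cat; apply: perm_map; apply: uniq_perm; rewrite ?enum_uniq //.
    rewrite cat_uniq uH filter_uniq ?enum_uniq // andbT -all_predC.
    by apply/allP=> H; rewrite mem_filter => /andP[].
  move=> H; rewrite mem_cat mem_filter; case: (boolP (H \in Hs)) => //= /sH.
  by rewrite mem_enum => ->.
have R0 : 0 \notin R ++ xs' by rewrite -(perm_mem pR) comp_sizes_gt0.
have xs0 : 0 \notin xs by rewrite -(perm_mem (perm_eq_seq_mset xs)).
have E : ((CS e `\` seq_mset xs') `+` seq_mset xs)%mset = seq_mset (R ++ xs).
  rewrite (_ : CS e = seq_mset (R ++ xs')); last exact/eq_seq_msetP.
  apply/msetP=> a; rewrite !msetE2 !mset_seqE !count_cat; lia.
(* The edges of [e] are among those of [eh], so the number of added edges is a difference of edge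
   counts, which depends on the component sizes only. *)
have cost eh : cluster_graph eh -> subrel e eh -> perm_eq (comp_sizes eh) (R ++ xs) ->
    #|edges eh :\: edges e| = \sum_(x <- xs) 'C(x, 2) - \sum_(x <- xs') 'C(x, 2).
  move=> ceh sub pRh; rewrite cardsDS; last first.
    apply/subsetP=> A; rewrite !inE => /existsP[x /existsP[y /andP[/sub exy A_]]].
    by apply/existsP; exists x; apply/existsP; exists y; rewrite exy.
  rewrite !card_edges_cluster // (perm_big _ pR) (perm_big _ pRh) !big_cat /=; lia.
split=> [[eh [[ceh sub]]]|[ref le]].
  rewrite E => /eq_seq_msetP pRh; rewrite cost // => le; split=> //.
  apply: (refines_cat_cancel R0); apply: refines_perml pR _.
  by apply: refines_permr pRh _; apply: comp_sizes_refine => //; case: ceh.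
have [||eh [ceh sub pRh]] := @refines_comp_sizes _ e (R ++ xs) se.
- by move: R0; rewrite !mem_cat !negb_or => /andP[->].
- by apply: refines_perml (refines_cat R ref); rewrite perm_sym.
by exists eh; rewrite cost //; split=> //; split=> //; rewrite E; apply/eq_seq_msetP.
Qed.

Lemma size_leq_sumn (s : seq nat) : 0 \notin s -> size s <= sumn s.
Proof.
elim: s => //= x s IH; rewrite inE negb_or => /andP[x0 /IH]; lia.
Qed.

Lemma is_partition_seq l (xs : seq nat) : is_partition l (seq_mset xs) ->
  [/\ 0 < l, 0 \notin xs & sumn xs = l].
Proof.
case=> l0 x0 xl; have p := perm_eq_seq_mset xs.
by split; [| rewrite -(perm_mem p) | rewrite sumnE -(perm_big _ p)].
Qed.

(** The chosen components are disjoint. Hence [l] is at most [n], which turns the polynomial factor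
    in [l] of the running time into one in [n]. *)
Lemma graph_valid_sumn (T : finType) (e : rel T) (xs : seq nat) :
  simple_graph e -> graph_valid e (seq_mset xs) -> sumn xs <= #|T|.
Proof.
move=> se [Hs [uH sH /eq_seq_msetP pH]].
have /and3P[_ tI _] := components_partition se.
have tIH : trivIset [set:: Hs].
  by apply: trivIsetS tI; apply/subsetP=> H; rewrite inE => /sH.
rewrite -(perm_sumn pH) sumnE big_map big_uniq //=.
rewrite (eq_bigl (mem [set:: Hs])) => [|H]; last by rewrite !inE.
by move/eqP: tIH => ->; exact: max_card.
Qed.

(** * Enumerating compositions by bit strings *)

(* [c] is read as an [l]-bit string, [P = 2 ^ l], top bit first: doubling [c]
   and comparing with [P] extracts a bit.  A bit 1 ends the current part, of
   length [cur]; finished parts are collected in [ps]. *)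
Definition bit_step (P : nat) (st : nat * nat * seq nat) :=
  let: (c, cur, ps) := st in
  if P <= c + c then (c + c - P, 0, cur.+1 :: ps) else (c + c, cur.+1, ps).

(* The end of a bin always ends the current part, possibly adding a part 0,
   which is never counted. *)
Definition bin_scan (P : nat) (st : nat * nat * seq nat) (x : nat) :=
  let: (c, cur, ps) := iter x (bit_step P) st in (c, 0, cur :: ps).

Definition scan (P : nat) (xs : seq nat) (c : nat) :=
  foldl (bin_scan P) (c, 0, [::]) xs.

Definition cut_parts (P : nat) (xs : seq nat) (c : nat) := (scan P xs c).2.

(** Each bit accounts for one unit of length, in the current part or in the part that it ends. *)
Lemma iter_bit_step P x c cur ps :
  exists c' cur' qs, iter x (bit_step P) (c, cur, ps) = (c', cur', qs ++ ps) /\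
    cur' + sumn qs = cur + x.
Proof.
elim: x => [|x [c' [cur' [qs [E S]]]]]; first by exists c, cur, [::].
rewrite iterS E /=; case: ifP => _.
  by exists (c' + c' - P), 0, (cur'.+1 :: qs); split=> //=; lia.
by exists (c' + c'), cur'.+1, qs; split=> //; lia.
Qed.

(** Soundness, for every candidate [c]: whatever the bits are, the parts cut inside a bin form a
    group whose sum is the length of the bin. *)
Lemma foldl_bin_scan P xs c ps :
  exists c' zs, [/\ (foldl (bin_scan P) (c, 0, ps) xs).1 = (c', 0),
    perm_eq (foldl (bin_scan P) (c, 0, ps) xs).2 (flatten zs ++ ps) &
    map sumn zs = xs].
Proof.
elim: xs c ps => [|x xs IH] c ps; first by exists c, [::].
rewrite /= {2 4}/bin_scan.
have [c' [cur' [qs [-> S]]]] := iter_bit_step P x c 0 ps.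
have [c2 [zs [E1 E2 E3]]] := IH c' (cur' :: qs ++ ps).
exists c2, ((cur' :: qs) :: zs); split=> //; last by rewrite /= E3 S.
by rewrite (permPl E2) -cat_cons perm_catCA catA.
Qed.

(** Comparing the values from 1 to [l] suffices: both lists sum to [l], so nothing larger occurs,
    and the parts 0 added at the ends of bins must be ignored. *)
Definition accepting (l : nat) (xs xs' : seq nat) (c : nat) :=
  all (fun v => count_mem v (cut_parts (2 ^ l) xs c) == count_mem v xs') (iota 1 l).

Lemma mem_leq_sumn x (s : seq nat) : x \in s -> x <= sumn s.
Proof.
elim: s => //= y s IH; rewrite inE => /orP[/eqP->|/IH]; lia.
Qed.

Lemma count_mem_gt_sumn v (s : seq nat) : sumn s < v -> count_mem v s = 0.
Proof.
by move=> sv; apply/count_memPn; apply/negP=> /mem_leq_sumn; lia.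
Qed.

Lemma accepting_refines l xs xs' c :
  sumn xs = l -> sumn xs' = l -> 0 \notin xs' ->
  accepting l xs xs' c -> refines xs' xs.
Proof.
move=> Exs Exs' x0 /allP acc.
have [c' [zs [_ pz Ez]]] := foldl_bin_scan (2 ^ l) xs c [::].
rewrite cats0 -/(scan _ _ _) -/(cut_parts _ _ _) in pz.
have szs : sumn (flatten zs) = l by rewrite sumn_flatten Ez.
(* Removing the parts 0 leaves the sums of the groups unchanged. *)
exists (map (filter (predC1 0)) zs); last first.
  rewrite -map_comp -Ez; apply/permP => p; congr count; apply/eq_map => z /=.
  by elim: z => //= -[|a] z IH //=; rewrite IH.
rewrite -filter_flatten; apply/allP => v _ /=; apply/eqP; rewrite count_filter.
have [->|v0] := posnP v.
  rewrite (count_memPn x0); apply/eqP; rewrite -leqn0 leqNgt -has_count.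
  by apply/hasPn => y _ /=; case: y.
rewrite (@eq_count _ _ (pred1 v)) => [|y /=]; last by case: eqP v0 => // -> ; lia.
have [vl|vl] := leqP v l; last by rewrite !count_mem_gt_sumn ?szs ?Exs'.
have vi : v \in iota 1 l by rewrite mem_iota; lia.
by rewrite -(eqP (acc v vi)) (permP pz).
Qed.

(** Runs a step backwards: [c1] is shifted right and [b] becomes the top bit. The divisibility says
    that the [m.+1] low bits of [c1] are vacant, so [m] of them are still vacant in [c]. *)
Lemma bit_step_pre l m (b : bool) c1 : m < l -> c1 < 2 ^ l -> 2 ^ m.+1 %| c1 ->
  exists c, [/\ c < 2 ^ l, 2 ^ m %| c & c + c = b * 2 ^ l + c1].
Proof.
move=> ml c1l /dvdnP[q Eq].
have El : 2 ^ l = 2 ^ (l - m.+1) * 2 ^ m * 2.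
  by rewrite -mulnA -expnSr -expnD subnK.
exists ((b * 2 ^ (l - m.+1) + q) * 2 ^ m); split; last 2 first.
- exact: dvdn_mull.
- by rewrite El Eq expnS; case: b; nia.
rewrite Eq expnS in c1l; rewrite El in c1l *; case: b; nia.
Qed.

(** Puts in front of [c1] the bits of a single part, namely [a - 1] zeros followed by a one. *)
Lemma iter_bit_step_pre l m a cur c1 ps : 0 < a -> m + a <= l -> c1 < 2 ^ l ->
  2 ^ (m + a) %| c1 ->
  exists c, [/\ c < 2 ^ l, 2 ^ m %| c &
    iter a (bit_step (2 ^ l)) (c, cur, ps) = (c1, 0, cur + a :: ps)].
Proof.
case: a => // a _; elim: a m cur c1 => [|a IH] m cur c1 mal c1l dv.
  have [|//||c [cl dc E]] := @bit_step_pre l m true c1; [lia | by rewrite addn1 in dv|].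
  exists c; split=> //=; rewrite ifT; last lia.
  by congr (_, _, _ :: _); lia.
have [|//||c' [c'l dc' E']] := IH m.+1 cur.+1 c1; [lia | by rewrite addSnnS|].
have [|//|//|c [cl dc E]] := @bit_step_pre l m false c'; first lia.
rewrite mul0n add0n in E.
have Es : bit_step (2 ^ l) (c, cur, ps) = (c', cur.+1, ps).
  by rewrite /= E leqNgt c'l.
by exists c; split=> //; rewrite iterSr Es E'; congr (_, _, _ :: _); lia.
Qed.

Lemma iter_sumn_bit_step_pre l m z c1 ps : 0 \notin z -> m + sumn z <= l ->
  c1 < 2 ^ l -> 2 ^ (m + sumn z) %| c1 ->
  exists c, [/\ c < 2 ^ l, 2 ^ m %| c &
    iter (sumn z) (bit_step (2 ^ l)) (c, 0, ps) = (c1, 0, rev z ++ ps)].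
Proof.
elim: z m ps => [|a z IH] m ps /=; first by exists c1; rewrite addn0 in H2.
rewrite inE negb_or => /andP[a0 z0] ml c1l dv.
have [//|||c' [c'l dc' E']] := IH (m + a) (a :: ps) z0.
- by rewrite -addnA.
- by [].
- by rewrite -addnA.
have [||//||c [cl dc E]] := @iter_bit_step_pre l m a 0 c' ps; rewrite ?lt0n 1?eq_sym //; first lia.
exists c; split=> //; rewrite addnC iterD E add0n E' rev_cons cat_rcons //.
Qed.

(** Completeness: the candidate is built from the last bin backwards, starting from 0, and its [m]
    low bits stay vacant for the bins scanned earlier. Only positive values are compared, since
    every bin here ends with a cut and then adds a part 0. *)
Lemma scan_pre l m zs ps : 0 \notin flatten zs -> m + sumn (flatten zs) = l ->
  exists c, [/\ c < 2 ^ l, 2 ^ m %| c &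
    forall v, 0 < v -> count_mem v (foldl (bin_scan (2 ^ l)) (c, 0, ps) (map sumn zs)).2
       = count_mem v (flatten zs) + count_mem v ps].
Proof.
elim: zs m ps => [|z zs IH] m ps /=; first by exists 0; rewrite expn_gt0 dvdn0.
rewrite mem_cat negb_or sumn_cat => /andP[z0 zs0] E.
have [|c' [c'l dc' E']] := IH (m + sumn z) (0 :: rev z ++ ps) zs0.
  by rewrite -addnA.
have [||//||c [cl dc Ec]] := @iter_sumn_bit_step_pre l m z c' ps; rewrite //; first lia.
exists c; split=> // v v0; rewrite {2}/bin_scan Ec E' //= !count_cat count_rev.
by case: eqP v0 => [<-//|_ _] /=; lia.
Qed.

Lemma refines_accepting l xs xs' : sumn xs = l -> 0 \notin xs' ->
  refines xs' xs -> exists2 c, c < 2 ^ l & accepting l xs xs' c.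
Proof.
move=> Exs x0 [ys py /perm_map_inv[zs pyz Ez]].
have pz : perm_eq (flatten zs) xs' by rewrite -(permPr py) perm_sym perm_flatten.
have [||c [cl _ E]] := @scan_pre l 0 zs [::].
- by rewrite (perm_mem pz).
- by rewrite sumn_flatten Ez.
exists c => //; apply/allP => v; rewrite mem_iota => /andP[v0 _].
by rewrite /cut_parts /scan -Ez E // addn0 (permP pz).
Qed.

Lemma bit_step_bounds P x c cur ps : c < P ->
  let st := iter x (bit_step P) (c, cur, ps) in
  [/\ st.1.1 < P, st.1.2 <= cur + x & size st.2 <= size ps + x].
Proof.
move=> cP /=; elim: x => [|x]; first by split=> //=; lia.
rewrite iterS; case: (iter x _ _) => -[c' cur'] ps' /= [h1 h2 h3].
by case: ifP => /= h; split; lia.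
Qed.

Lemma scan_rcons P xs x c : scan P (rcons xs x) c = bin_scan P (scan P xs c) x.
Proof. by rewrite /scan -cats1 foldl_cat. Qed.

Lemma scan_bounds P xs c : c < P ->
  [/\ (scan P xs c).1.1 < P, (scan P xs c).1.2 = 0
    & size (scan P xs c).2 <= sumn xs + size xs].
Proof.
move=> cP; elim/last_ind: xs => [|xs x]; first by [].
rewrite scan_rcons sumn_rcons size_rcons /bin_scan.
case: (scan P xs c) => -[c' cur'] ps /= [h1 h2 h3].
have := bit_step_bounds x cur' ps h1.
by case: (iter x _ _) => -[c2 cur2] ps2 /= [k1 k2 k3]; split=> //; lia.
Qed.

(** * The word RAM program *)

Local Notation Sub := Defs.Sub.
Local Notation mem := Defs.mem.

(** * Timed runs on lists of register values *)

Section Runs.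

Variables (w : nat) (m : nat -> nat).

(** A list stands for a register file that is 0 past its end, so that runs can be computed; the
    match is pointwise because [reg] is a function. The memory [m] is the same before and after. *)
Definition runs (p : cmd) (L : seq nat) (T : nat) (L' : seq nat) :=
  forall s, reg s =1 nth 0 L -> mem s = m ->
  exists t s', [/\ exec w p s t s', t <= T, reg s' =1 nth 0 L' & mem s' = m].

Lemma runs_leq p L T T' L' : T <= T' -> runs p L T L' -> runs p L T' L'.
Proof.
move=> TT H s rs ms; have [t [s' [h1 h2 h3 h4]]] := H s rs ms.
by exists t, s'; split=> //; exact: leq_trans h2 TT.
Qed.

Lemma runs_seq p q L1 L2 L3 T1 T2 :
  runs p L1 T1 L2 -> runs q L2 T2 L3 -> runs (Seq p q) L1 (T1 + T2) L3.
Proof.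
move=> Hp Hq s rs ms; have [t1 [s1 [e1 l1 r1 m1]]] := Hp s rs ms.
have [t2 [s2 [e2 l2 r2 m2]]] := Hq s1 r1 m1.
by exists (t1 + t2), s2; split=> //; [exact: ExecSeq e1 e2 | exact: leq_add].
Qed.

(** [g i] is the register file before round [i]. Each round pays one unit for its test, and the
    final failing test pays one more. *)
Lemma runs_while r p T N (g : nat -> seq nat) :
  (forall i, i < N -> nth 0 (g i) r != 0) -> nth 0 (g N) r = 0 ->
  (forall i, i < N -> runs p (g i) T (g i.+1)) ->
  runs (While r p) (g 0) (N * T.+1).+1 (g N).
Proof.
elim: N g => [|N IH] g gt0 g0 body s rs ms.
  by exists 1, s; split=> //; apply: ExecWhileF; rewrite rs.
have [t1 [s1 [e1 l1 r1 m1]]] := body 0 (ltn0Sn _) s rs ms.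
have [t2 [s2 [e2 l2 r2 m2]]] := IH (fun i => g i.+1) (fun i => gt0 i.+1) g0
  (fun i => body i.+1) s1 r1 m1.
exists (t1 + t2).+1, s2; split=> //; last lia.
by apply: ExecWhileT e1 e2; rewrite rs gt0.
Qed.

Fixpoint straight (p : cmd) : bool :=
  match p with
  | Seq p q | If _ p q => straight p && straight q
  | While _ _ | Write _ _ => false
  | _ => true
  end.

Fixpoint duration (p : cmd) : nat :=
  match p with
  | Seq p q => duration p + duration q
  | If _ p q => (maxn (duration p) (duration q)).+1
  | _ => 1
  end.

(** An evaluator for code satisfying [straight], with [W] the modulus; on [While] and [Write] its
    value is a mere default. *)
Fixpoint sem (W : nat) (p : cmd) (L : seq nat) : seq nat :=
  match p with
  | Const r v => set_nth 0 L r (v %% W)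
  | Move r a => set_nth 0 L r (nth 0 L a)
  | Add r a b => set_nth 0 L r ((nth 0 L a + nth 0 L b) %% W)
  | Sub r a b => set_nth 0 L r (nth 0 L a - nth 0 L b)
  | Read r a => set_nth 0 L r (m (nth 0 L a))
  | Seq p q => sem W q (sem W p L)
  | If r p q => if nth 0 L r == 0 then sem W q L else sem W p L
  | _ => L
  end.

Lemma upd_set_nth (f : nat -> nat) L r v v' :
  f =1 nth 0 L -> v = v' -> upd f r v =1 nth 0 (set_nth 0 L r v').
Proof. by move=> E -> j; rewrite nth_set_nth /= /upd E. Qed.

Lemma runs_straight p L L' : straight p -> sem (2 ^ w) p L = L' ->
  runs p L (duration p) L'.
Proof.
move=> sp <- {L'}.
elim: p sp L => //=.
- by move=> _ L s rs ms; exists 1, s; split=> //; exact: ExecSkip.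
- move=> r v _ L s rs ms; exists 1; eexists; split; first exact: ExecConst.
  + by [].
  + exact: upd_set_nth.
  + by [].
- move=> r a _ L s rs ms; exists 1; eexists; split; first exact: ExecMove.
  + by [].
  + exact: upd_set_nth.
  + by [].
- move=> r a b _ L s rs ms; exists 1; eexists; split; first exact: ExecAdd.
  + by [].
  + by apply: upd_set_nth; rewrite ?rs.
  + by [].
- move=> r a b _ L s rs ms; exists 1; eexists; split; first exact: ExecSub.
  + by [].
  + by apply: upd_set_nth; rewrite ?rs.
  + by [].
- move=> r a _ L s rs ms; exists 1; eexists; split; first exact: ExecRead.
  + by [].
  + by apply: upd_set_nth; rewrite ?rs ?ms.
  + by [].
- move=> p IHp q IHq /andP[sp sq] L.
  exact: runs_seq (IHp sp L) (IHq sq _).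
- move=> r p IHp q IHq /andP[sp sq] L s rs ms; case: (eqVneq (nth 0 L r) 0) => Lr.
    have [t [s' [e tl r' m']]] := IHq sq L s rs ms.
    exists t.+1, s'; split=> //; last by rewrite ltnS leq_max tl orbT.
    by apply: ExecIfF => //; rewrite rs.
  have [t [s' [e tl r' m']]] := IHp sp L s rs ms.
  exists t.+1, s'; split=> //; last by rewrite ltnS leq_max tl.
  by apply: ExecIfT => //; rewrite rs.
Qed.

End Runs.

(** * Registers and code of the program *)

Definition block (ps : seq cmd) : cmd := foldr Seq Skip ps.

Local Notation rfound := 0.
Local Notation rone := 1.
Local Notation rl := 2.
Local Notation rP := 3.
Local Notation rA := 4.
Local Notation rB := 5.
Local Notation rc := 6.
Local Notation rv := 7.
Local Notation rbits := 8.
Local Notation rcnt := 9.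
Local Notation rcnt' := 10.
Local Notation rcur := 11.
Local Notation ri := 12.
Local Notation raddr := 13.
Local Notation rx := 14.
Local Notation rt := 15.
Local Notation ru := 16.
Local Notation rmis := 17.

(* Registers [rt] and [ru] are scratch and are reset to 0 by every block, so that
   all reachable register files between blocks have this shape. *)
Definition frame found l P A B c v bits cnt cnt' cur i addr x mis : seq nat :=
  [:: found; 1; l; P; A; B; c; v; bits; cnt; cnt'; cur; i; addr; x; 0; 0; mis].

(** Equality is tested by two truncated subtractions: [a] and [rv] agree iff both differences are
    0. *)
Definition count_if_eq (a cnt : nat) : cmd :=
  block [:: Sub rt a rv; Sub ru rv a;
    If rt Skip (If ru Skip (Add cnt cnt rone)); Const rt 0; Const ru 0; Const a 0].

(** Performs [bit_step], but of the list of parts it keeps only the number of those equal to the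
    value in [rv]. The difference in [rt] is nonzero exactly when the extracted bit is 0. *)
Definition bit_body : cmd :=
  block [:: Add rcur rcur rone; Add rbits rbits rbits; Sub rt rP rbits;
    If rt (Const rt 0) (Seq (Sub rbits rbits rP) (count_if_eq rcur rcnt));
    Sub rx rx rone].

Definition next : cmd := Seq (Add raddr raddr rone) (Sub ri ri rone).

Definition bin_body : cmd :=
  Seq (Read rx raddr) (Seq (While rx bit_body) (Seq (count_if_eq rcur rcnt) next)).

Definition item_body : cmd :=
  block [:: Read rx raddr; count_if_eq rx rcnt'; next].

(** Cells 2 and 3 hold the lengths of the two lists, which start at address 4; after the loop over
    the bins, [raddr] points to the start of the second list. *)
Definition value_body : cmd :=
  Seq (block [:: Move rbits rc; Const ri 2; Read ri ri; Const raddr 4])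
  (Seq (While ri bin_body)
  (Seq (Seq (Const ri 3) (Read ri ri))
  (Seq (While ri item_body)
  (block [:: Sub rt rcnt rcnt'; Sub ru rcnt' rcnt; If rt (Const rmis 1) Skip;
    If ru (Const rmis 1) Skip; Const rt 0; Const ru 0; Const rcnt 0; Const rcnt' 0;
    Const rbits 0; Const raddr 0; Sub rv rv rone])))).

(* [Sub] goes first: the loop over [rc] visits the candidates 2^l - 1, ..., 0. *)
Definition candidate_body : cmd :=
  Seq (Seq (Sub rc rc rone) (Move rv rl))
  (Seq (While rv value_body)
  (Seq (If rmis Skip (Const rfound 1)) (Const rmis 0))).

(** Iterated, it adds [x - 1], [x - 2], ..., 0 to [acc], which gives 'C(x, 2) without
    multiplication. *)
Definition triangle_body (acc : nat) : cmd :=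
  Seq (Sub rx rx rone) (Add acc acc rx).

Definition total_body : cmd :=
  Seq (Seq (Read rx raddr) (Add rl rl rx)) (Seq (While rx (triangle_body rA)) next).

Definition total_body' : cmd :=
  Seq (Read rx raddr) (Seq (While rx (triangle_body rB)) next).

Definition power_body : cmd := Seq (Add rP rP rP) (Sub rx rx rone).

(** The phases: [l] and the edge count of [xs], the edge count of [xs'], the power [2 ^ l] by
    doubling, the search over candidates. The last block withdraws a positive answer if the cost
    exceeds the budget [k] in cell 1. *)
Definition acm_program : cmd :=
  Seq (block [:: Const rone 1; Const ri 2; Read ri ri; Const raddr 4])
  (Seq (While ri total_body)
  (Seq (Seq (Const ri 3) (Read ri ri))
  (Seq (While ri total_body')
  (Seq (block [:: Const raddr 0; Const rP 1; Move rx rl])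
  (Seq (While rx power_body)
  (Seq (Move rc rP)
  (Seq (While rc candidate_body)
  (block [:: Sub rA rA rB; Const rt 1; Read rt rt; Sub rA rA rt;
    If rA (Const rfound 0) Skip])))))))).

Lemma sumn_take_leq (s : seq nat) j : sumn (take j s) <= sumn s.
Proof. by rewrite -{2}(cat_take_drop j s) sumn_cat leq_addr. Qed.

Lemma sum_bin2_leq (s : seq nat) : \sum_(x <- s) 'C(x, 2) <= sumn s * sumn s.
Proof.
elim: s => [|x s IH]; first by rewrite big_nil.
by rewrite big_cons /=; have := bin2 x; nia.
Qed.

(** * Correctness and running time of the program *)

Section Correctness.

Variables (w : nat) (m : nat -> nat) (xs xs' : seq nat) (l P : nat).
Hypotheses (sum_xs : sumn xs = l) (sum_xs' : sumn xs' = l) (P_def : P = 2 ^ l).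
Hypotheses (size_xs : size xs <= l) (size_xs' : size xs' <= l).
Hypothesis l_gt0 : 0 < l.
Hypothesis word : 20 * (P * l) <= 2 ^ w.
Hypotheses (m2 : m 2 = size xs) (m3 : m 3 = size xs').
Hypothesis m_xs : forall i, i < size xs -> m (4 + i) = nth 0 xs i.
Hypothesis m_xs' : forall i, i < size xs' -> m (4 + size xs + i) = nth 0 xs' i.

Notation runs := (runs w m).

(** These bounds exclude wrap-around in each register: candidates and powers are of order [P], edge
    counts of order [l * l], and lengths, counts and addresses of order [l]. *)
Lemma word_bounds :
  [/\ 20 * P <= 2 ^ w, 20 * (l * l) <= 2 ^ w, 20 * l <= 2 ^ w & 20 <= 2 ^ w].
Proof.
have lP : l < P by rewrite P_def ltn_expl.
by split; apply: leq_trans word; nia.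
Qed.

(** The list [ps] exists only in the specification; the machine sees its count of [v]. The bound
    [3 * l] leaves room for at most [l] parts ended by cuts and at most [l] ended by bins. *)
Lemma run_bit found A B c v bits (ps : seq nat) cnt' cur i addr x mis :
  bits < P -> cur <= l -> size ps < 3 * l ->
  runs bit_body
   (frame found l P A B c v bits (count_mem v ps) cnt' cur i addr x mis) 20
   (let st := bit_step P (bits, cur, ps) in
    frame found l P A B c v st.1.1 (count_mem v st.2) cnt' st.1.2 i addr (x - 1) mis).
Proof.
move=> hb hc hp; apply: runs_leq (runs_straight (L' := _) _ _); [by [] | by [] |].
have [W1 _ W2 W3] := word_bounds.
have cp : (count_mem v ps).+1 < 2 ^ w.
  by apply: (@leq_ltn_trans (size ps).+1); [exact: count_size | lia].
rewrite /= !mod0n !modn_small ?addn1; try first [exact: cp | lia].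
rewrite subn_eq0; case: ifP => _ /=; last by [].
have -> : (cur.+1 == v) = (cur.+1 - v == 0) && (v - cur.+1 == 0) by lia.
by case: eqP => _ //=; case: eqP => _ //=.
Qed.

Lemma run_bits found A B c v (st : nat * nat * seq nat) cnt' i addr x mis :
  st.1.1 < P -> st.1.2 = 0 -> size st.2 + x < 3 * l -> x <= l ->
  runs (While rx bit_body)
   (frame found l P A B c v st.1.1 (count_mem v st.2) cnt' st.1.2 i addr x mis)
   (x * 21).+1
   (let st' := iter x (bit_step P) st in
    frame found l P A B c v st'.1.1 (count_mem v st'.2) cnt' st'.1.2 i addr 0 mis).
Proof.
case: st => -[b cur] ps /= hb -> hs hx.
pose g j := let st' := iter j (bit_step P) (b, 0, ps) in
  frame found l P A B c v st'.1.1 (count_mem v st'.2) cnt' st'.1.2 i addr (x - j) mis.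
have : runs (While rx bit_body) (g 0) (x * 21).+1 (g x).
  apply: runs_while => [j jx||j jx] /=; [lia|lia|].
  have := bit_step_bounds j 0 ps hb; rewrite /g iterS.
  case: (iter j _ _) => -[b' cur'] ps' /= [h1 h2 h3].
  have -> : x - j.+1 = x - j - 1 by lia.
  by apply: run_bit; lia.
by rewrite /g subn0 subnn.
Qed.

Lemma run_bin found A B c v (st : nat * nat * seq nat) cnt' i addr x mis :
  st.1.1 < P -> st.1.2 = 0 -> size st.2 + x < 3 * l -> x <= l ->
  m addr = x -> addr < 4 + l + l ->
  runs bin_body
   (frame found l P A B c v st.1.1 (count_mem v st.2) cnt' st.1.2 i addr 0 mis)
   (l * 21 + 20)
   (let st' := bin_scan P st x in
    frame found l P A B c v st'.1.1 (count_mem v st'.2) cnt' st'.1.2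
      (i - 1) addr.+1 0 mis).
Proof.
move=> hb h0 hs hx Em ha; have [W1 _ W2 W3] := word_bounds.
have R1 : runs (Read rx raddr)
   (frame found l P A B c v st.1.1 (count_mem v st.2) cnt' st.1.2 i addr 0 mis) 1
   (frame found l P A B c v st.1.1 (count_mem v st.2) cnt' st.1.2 i addr x mis).
  by apply: runs_straight; rewrite //= Em.
have R2 := @run_bits found A B c v st cnt' i addr x mis hb h0 hs hx.
apply: runs_leq (runs_seq R1 (runs_seq R2 (runs_straight (L' := _) _ _))); first 2 last.
- rewrite /bin_scan.
  have := bit_step_bounds x st.1.2 st.2 hb; rewrite -!surjective_pairing h0.
  case: (iter x _ _) => -[b' cur'] ps' /= [h1 h2 h3].
  have cp : (count_mem v ps').+1 < 2 ^ w.
    by apply: (@leq_ltn_trans (size ps').+1); [exact: count_size | lia].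
  rewrite !mod0n.
  have -> : (cur' == v) = (cur' - v == 0) && (v - cur' == 0) by lia.
  case: eqP => _ /=; last by rewrite !modn_small ?addn1; try lia.
  by case: eqP => _ /=; rewrite !modn_small ?addn1; try first [exact: cp | lia].
- by rewrite /=; lia.
- by [].
Qed.

Lemma run_bins found A B c v mis : c < P ->
  runs (While ri bin_body)
   (frame found l P A B c v c 0 0 0 (size xs) 4 0 mis)
   (size xs * (l * 21 + 20).+1).+1
   (let st := scan P xs c in
    frame found l P A B c v st.1.1 (count_mem v st.2) 0 0 0 (4 + size xs) 0 mis).
Proof.
move=> cP.
pose g j := let st := scan P (take j xs) c in
  frame found l P A B c v st.1.1 (count_mem v st.2) 0 st.1.2 (size xs - j) (4 + j) 0 mis.
have : runs (While ri bin_body) (g 0) (size xs * (l * 21 + 20).+1).+1 (g (size xs)).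
  apply: runs_while => [j jx||j jx] /=; [lia|lia|].
  have [h1 h2 h3] := scan_bounds (take j xs) cP.
  rewrite /g (take_nth 0 jx) scan_rcons.
  have -> : size xs - j.+1 = size xs - j - 1 by lia.
  rewrite [4 + j.+1]addnS; apply: run_bin => //; last 2 first.
  - exact: m_xs.
  - by lia.
  - have := sumn_take_leq xs j.+1; rewrite (take_nth 0 jx) sumn_rcons sum_xs.
    by move: h3; rewrite size_take jx; lia.
  - by rewrite -sum_xs (mem_leq_sumn (mem_nth 0 jx)).
have [_ h2 _] := scan_bounds xs cP.
by rewrite /g take_size take0 subn0 subnn addn0 h2.
Qed.

Lemma run_items found A B c v bits cnt mis :
  runs (While ri item_body)
   (frame found l P A B c v bits cnt 0 0 (size xs') (4 + size xs) 0 mis)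
   (size xs' * 20).+1
   (frame found l P A B c v bits cnt (count_mem v xs') 0 0
     (4 + size xs + size xs') 0 mis).
Proof.
pose g j := frame found l P A B c v bits cnt (count_mem v (take j xs')) 0
  (size xs' - j) (4 + size xs + j) 0 mis.
have : runs (While ri item_body) (g 0) (size xs' * 20).+1 (g (size xs')).
  apply: runs_while => [j jx||j jx] /=; [lia|lia|].
  apply: runs_leq (runs_straight (L' := _) _ _); [by [] | by [] |].
  have [W1 _ W2 W3] := word_bounds.
  have cp : (count_mem v (take j xs')).+1 < 2 ^ w.
    by apply: (@leq_ltn_trans (size (take j xs')).+1);
      [exact: count_size | rewrite size_take jx; lia].
  rewrite /g (take_nth 0 jx) -cats1 count_cat /= !mod0n m_xs' //.
  set x := nth 0 xs' j.
  have -> : (x == v) = (x - v == 0) && (v - x == 0) by lia.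
  rewrite addn0 [_ + j.+1]addnS subnS -subn1.
  case: eqP => _ /=; last by rewrite !modn_small ?addn1 ?addn0; try lia.
  by case: eqP => _ /=; rewrite !modn_small ?addn1 ?addn0; try first [exact: cp | lia].
by rewrite /g take_size take0 subn0 subnn addn0.
Qed.

Definition count_differs c v :=
  count_mem v (cut_parts P xs c) != count_mem v xs'.

Lemma run_value found A B c v mis : c < P ->
  runs value_body
   (frame found l P A B c v 0 0 0 0 0 0 0 (nat_of_bool mis)) (120 * (l * l))
   (frame found l P A B c (v - 1) 0 0 0 0 0 0 0 (nat_of_bool (count_differs c v || mis))).
Proof.
move=> cP; have [W1 _ W2 W3] := word_bounds; set mis' := nat_of_bool mis.
have R1 : runs (block [:: Move rbits rc; Const ri 2; Read ri ri; Const raddr 4])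
    (frame found l P A B c v 0 0 0 0 0 0 0 mis') 5
    (frame found l P A B c v c 0 0 0 (size xs) 4 0 mis').
  by apply: runs_straight; rewrite //= !modn_small ?m2 //; lia.
have R2 := @run_bins found A B c v mis' cP.
set st := scan P xs c in R2.
have R3 : runs (Seq (Const ri 3) (Read ri ri))
    (frame found l P A B c v st.1.1 (count_mem v st.2) 0 0 0 (4 + size xs) 0 mis') 2
    (frame found l P A B c v st.1.1 (count_mem v st.2) 0 0 (size xs') (4 + size xs) 0 mis').
  by apply: runs_straight; rewrite //= !modn_small ?m3 //; lia.
have R4 := @run_items found A B c v st.1.1 (count_mem v st.2) mis'.
apply: runs_leq (runs_seq R1 (runs_seq R2 (runs_seq R3 (runs_seq R4
  (runs_straight (L' := _) _ _))))); first 2 last.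
- rewrite /count_differs /cut_parts -/st /= !mod0n.
  set a := count_mem v st.2; set b := count_mem v xs'.
  have -> : (a != b) = ~~ ((a - b == 0) && (b - a == 0)) by lia.
  by rewrite /mis'; case: (a - b == 0); case: (b - a == 0); rewrite /= ?modn_small //; lia.
- by rewrite /=; nia.
- by [].
Qed.

Lemma run_values found A B c : c < P ->
  runs (While rv value_body)
   (frame found l P A B c l 0 0 0 0 0 0 0 0) (l * (120 * (l * l)).+1).+1
   (frame found l P A B c 0 0 0 0 0 0 0 0 (nat_of_bool (~~ accepting l xs xs' c))).
Proof.
move=> cP.
(* The values are visited downwards, so after [j] rounds those from [l - j + 1] to [l] have been
   compared. *)
pose g j := frame found l P A B c (l - j) 0 0 0 0 0 0 0
  (nat_of_bool (has (count_differs c) (iota (l - j).+1 j))).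
have : runs (While rv value_body) (g 0) (l * (120 * (l * l)).+1).+1 (g l).
  apply: runs_while => [j jl||j jl] /=; [lia|lia|].
  rewrite /g; have -> : (l - j.+1).+1 = l - j by lia.
  have -> : l - j.+1 = l - j - 1 by lia.
  exact: run_value.
by rewrite /g subn0 subnn /accepting -P_def -has_predC.
Qed.

Lemma run_candidate found A B c : 0 < c -> c <= P ->
  runs candidate_body
   (frame (nat_of_bool found) l P A B c 0 0 0 0 0 0 0 0 0) (140 * (l * (l * l)))
   (frame (nat_of_bool (accepting l xs xs' (c - 1) || found)) l P A B (c - 1)
     0 0 0 0 0 0 0 0 0).
Proof.
move=> c0 cP; have [W1 _ W2 W3] := word_bounds.
have R1 : runs (Seq (Sub rc rc rone) (Move rv rl))
    (frame (nat_of_bool found) l P A B c 0 0 0 0 0 0 0 0 0) 2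
    (frame (nat_of_bool found) l P A B (c - 1) l 0 0 0 0 0 0 0 0).
  by apply: runs_straight.
have R2 : runs (While rv value_body) _ _ _ :=
  @run_values (nat_of_bool found) A B (c - 1) ltac:(lia).
apply: runs_leq (runs_seq R1 (runs_seq R2 (runs_straight (L' := _) _ _))); first 2 last.
- by case: accepting => /=; rewrite !modn_small //; lia.
- by rewrite /=; nia.
- by [].
Qed.

Lemma run_candidates A B :
  runs (While rc candidate_body)
   (frame 0 l P A B P 0 0 0 0 0 0 0 0 0) (P * (140 * (l * (l * l))).+1).+1
   (frame (nat_of_bool (has (accepting l xs xs') (iota 0 P))) l P A B
     0 0 0 0 0 0 0 0 0 0).
Proof.
pose g j := frame (nat_of_bool (has (accepting l xs xs') (iota (P - j) j)))
  l P A B (P - j) 0 0 0 0 0 0 0 0 0.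
have : runs (While rc candidate_body) (g 0) (P * (140 * (l * (l * l))).+1).+1 (g P).
  apply: runs_while => [j jP||j jP] /=; [lia|lia|].
  rewrite /g; have -> : iota (P - j.+1) j.+1 = (P - j - 1) :: iota (P - j) j.
    by rewrite /=; congr (_ :: iota _ _); lia.
  have -> : P - j.+1 = P - j - 1 by lia.
  by apply: run_candidate; lia.
by rewrite /g subn0 subnn.
Qed.

(** [l'] is separate from [l] because [rl] holds only a partial sum of [xs] while this loop runs. *)
Lemma run_triangle_A l' B i addr x A : x <= l -> A <= l * l ->
  runs (While rx (triangle_body rA))
   (frame 0 l' 0 A B 0 0 0 0 0 0 i addr x 0) (x * 3).+1
   (frame 0 l' 0 (A + 'C(x, 2)) B 0 0 0 0 0 0 i addr 0 0).
Proof.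
move=> xl Al; have [_ W1 W2 W3] := word_bounds.
(* After [j] rounds the added amount is the sum of [x - 1], ..., [x - j], which is this difference
   by Pascal's rule. *)
pose g j := frame 0 l' 0 (A + ('C(x, 2) - 'C(x - j, 2))) B 0 0 0 0 0 0 i addr (x - j) 0.
have : runs (While rx (triangle_body rA)) (g 0) (x * 3).+1 (g x).
  apply: runs_while => [j jx||j jx] /=; [lia|lia|].
  apply: runs_straight => //; rewrite /g.
  have [y Ey] : exists y, x - j = y.+1 by exists (x - j).-1; lia.
  have -> : x - j.+1 = y by lia.
  have b1 : 'C(y.+1, 2) <= 'C(x, 2) by apply: leq_bin2l; lia.
  have b2 : 'C(x, 2) <= l * l by rewrite bin2; nia.
  have b3 : 'C(y.+1, 2) = 'C(y, 2) + y by rewrite binS bin1 addnC.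
  have E : A + ('C(x, 2) - 'C(y.+1, 2)) + y = A + ('C(x, 2) - 'C(y, 2)) by lia.
  by rewrite Ey /= subn1 /= E modn_small //; nia.
by rewrite /g !subn0 !subnn addn0 bin0n subn0.
Qed.

Lemma run_triangle_B l' A i addr x B : x <= l -> B <= l * l ->
  runs (While rx (triangle_body rB))
   (frame 0 l' 0 A B 0 0 0 0 0 0 i addr x 0) (x * 3).+1
   (frame 0 l' 0 A (B + 'C(x, 2)) 0 0 0 0 0 0 i addr 0 0).
Proof.
move=> xl Bl; have [_ W1 W2 W3] := word_bounds.
pose g j := frame 0 l' 0 A (B + ('C(x, 2) - 'C(x - j, 2))) 0 0 0 0 0 0 i addr (x - j) 0.
have : runs (While rx (triangle_body rB)) (g 0) (x * 3).+1 (g x).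
  apply: runs_while => [j jx||j jx] /=; [lia|lia|].
  apply: runs_straight => //; rewrite /g.
  have [y Ey] : exists y, x - j = y.+1 by exists (x - j).-1; lia.
  have -> : x - j.+1 = y by lia.
  have b1 : 'C(y.+1, 2) <= 'C(x, 2) by apply: leq_bin2l; lia.
  have b2 : 'C(x, 2) <= l * l by rewrite bin2; nia.
  have b3 : 'C(y.+1, 2) = 'C(y, 2) + y by rewrite binS bin1 addnC.
  have E : B + ('C(x, 2) - 'C(y.+1, 2)) + y = B + ('C(x, 2) - 'C(y, 2)) by lia.
  by rewrite Ey /= subn1 /= E modn_small //; nia.
by rewrite /g !subn0 !subnn addn0 bin0n subn0.
Qed.

Lemma run_totals :
  runs (While ri total_body)
   (frame 0 0 0 0 0 0 0 0 0 0 0 (size xs) 4 0 0) (size xs * (l * 3 + 5).+1).+1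
   (frame 0 l 0 (\sum_(x <- xs) 'C(x, 2)) 0 0 0 0 0 0 0 0 (4 + size xs) 0 0).
Proof.
have [_ W1 W2 W3] := word_bounds.
pose g j := frame 0 (sumn (take j xs)) 0 (\sum_(x <- take j xs) 'C(x, 2)) 0
  0 0 0 0 0 0 (size xs - j) (4 + j) 0 0.
have : runs (While ri total_body) (g 0) (size xs * (l * 3 + 5).+1).+1 (g (size xs)).
  apply: runs_while => [j jx||j jx] /=; [lia|lia|].
  have Ej : size xs - j.+1 = size xs - j - 1 by lia.
  have xl := mem_leq_sumn (mem_nth 0 jx); rewrite sum_xs in xl.
  have t1 := sumn_take_leq xs j.+1; rewrite (take_nth 0 jx) sumn_rcons sum_xs in t1.
  have t2 := sum_bin2_leq (take j xs).
  rewrite /g (take_nth 0 jx) sumn_rcons -cats1 big_cat big_seq1 /= [4 + j.+1]addnS.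
  have := m_xs jx; move: (nth 0 xs j) xl t1 => x xl t1 mx.
  move: (sumn _) t1 t2 => S t1 t2; move: (\sum_(_ <- _) _) t2 => A t2.
  have R1 : runs (Seq (Read rx raddr) (Add rl rl rx))
      (frame 0 S 0 A 0 0 0 0 0 0 0 (size xs - j) (4 + j) 0 0) 2
      (frame 0 (S + x) 0 A 0 0 0 0 0 0 0 (size xs - j) (4 + j) x 0).
    by apply: runs_straight; rewrite //= mx modn_small //; lia.
  have R2 := @run_triangle_A (S + x) 0 (size xs - j) (4 + j) x A xl ltac:(nia).
  apply: runs_leq (runs_seq R1 (runs_seq R2 (runs_straight (L' := _) _ _))); first 2 last.
  - by rewrite /= modn_small ?addn1 ?Ej //; lia.
  - by rewrite /=; lia.
  - by [].
by rewrite /g take_size take0 subn0 subnn addn0 big_nil sum_xs.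
Qed.

Lemma run_totals' A :
  runs (While ri total_body')
   (frame 0 l 0 A 0 0 0 0 0 0 0 (size xs') (4 + size xs) 0 0)
   (size xs' * (l * 3 + 5).+1).+1
   (frame 0 l 0 A (\sum_(x <- xs') 'C(x, 2)) 0 0 0 0 0 0 0
     (4 + size xs + size xs') 0 0).
Proof.
have [_ W1 W2 W3] := word_bounds.
pose g j := frame 0 l 0 A (\sum_(x <- take j xs') 'C(x, 2))
  0 0 0 0 0 0 (size xs' - j) (4 + size xs + j) 0 0.
have : runs (While ri total_body') (g 0) (size xs' * (l * 3 + 5).+1).+1 (g (size xs')).
  apply: runs_while => [j jx||j jx] /=; [lia|lia|].
  have Ej : size xs' - j.+1 = size xs' - j - 1 by lia.
  have xl := mem_leq_sumn (mem_nth 0 jx); rewrite sum_xs' in xl.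
  have t1 := sumn_take_leq xs' j; rewrite sum_xs' in t1.
  have t2 := sum_bin2_leq (take j xs').
  rewrite /g (take_nth 0 jx) -cats1 big_cat big_seq1 /= [4 + size xs + j.+1]addnS.
  have := m_xs' jx; move: (nth 0 xs' j) xl => x xl mx.
  move: (sumn _) t1 t2 => S t1 t2; move: (\sum_(_ <- _) _) t2 => B t2.
  have R1 : runs (Read rx raddr)
      (frame 0 l 0 A B 0 0 0 0 0 0 (size xs' - j) (4 + size xs + j) 0 0) 1
      (frame 0 l 0 A B 0 0 0 0 0 0 (size xs' - j) (4 + size xs + j) x 0).
    by apply: runs_straight; rewrite //= mx.
  have R2 := @run_triangle_B l A (size xs' - j) (4 + size xs + j) x B xl ltac:(nia).
  apply: runs_leq (runs_seq R1 (runs_seq R2 (runs_straight (L' := _) _ _))); first 2 last.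
  - by rewrite /= modn_small ?addn1 ?Ej //; lia.
  - by rewrite /=; lia.
  - by [].
by rewrite /g take_size take0 subn0 subnn addn0 big_nil.
Qed.

Lemma run_power A B :
  runs (While rx power_body)
   (frame 0 l 1 A B 0 0 0 0 0 0 0 0 l 0) (l * 3).+1
   (frame 0 l P A B 0 0 0 0 0 0 0 0 0 0).
Proof.
have [W0 W1 W2 W3] := word_bounds.
pose g j := frame 0 l (2 ^ j) A B 0 0 0 0 0 0 0 0 (l - j) 0.
have : runs (While rx power_body) (g 0) (l * 3).+1 (g l).
  apply: runs_while => [j jl||j jl] /=; [lia|lia|].
  apply: runs_straight => //; rewrite /g /=.
  have e : 2 ^ j.+1 <= P by rewrite P_def leq_exp2l.
  have Ej : l - j.+1 = l - j - 1 by lia.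
  by rewrite Ej expnS mul2n -addnn modn_small // addnn -mul2n -expnS; lia.
by rewrite /g subn0 subnn -P_def.
Qed.

Lemma run_acm_program :
  exists L : seq nat,
    runs acm_program [::] (1000 * (P * (l * (l * l)))) L /\
    (nth 0 L 0 != 0) = has (accepting l xs xs') (iota 0 P) &&
      (\sum_(x <- xs) 'C(x, 2) - \sum_(x <- xs') 'C(x, 2) <= m 1).
Proof.
have [W0 W1 W2 W3] := word_bounds.
have lP : l < P by rewrite P_def ltn_expl.
set A := \sum_(x <- xs) _; set B := \sum_(x <- xs') _; set f := has _ _.
(* The initial registers are written as 18 zeros, so that the first block evaluates to a [frame];
   pointwise this is the empty list. *)
have R1 : runs (block [:: Const rone 1; Const ri 2; Read ri ri; Const raddr 4])
    (nseq 18 0) 5 (frame 0 0 0 0 0 0 0 0 0 0 0 (size xs) 4 0 0).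
  by apply: runs_straight; rewrite //= !modn_small ?m2 //; lia.
have R2 := @run_totals.
have R3 : runs (Seq (Const ri 3) (Read ri ri))
    (frame 0 l 0 A 0 0 0 0 0 0 0 0 (4 + size xs) 0 0) 2
    (frame 0 l 0 A 0 0 0 0 0 0 0 (size xs') (4 + size xs) 0 0).
  by apply: runs_straight; rewrite //= !modn_small ?m3 //; lia.
have R4 := @run_totals' A.
have R5 : runs (block [:: Const raddr 0; Const rP 1; Move rx rl])
    (frame 0 l 0 A B 0 0 0 0 0 0 0 (4 + size xs + size xs') 0 0) 4
    (frame 0 l 1 A B 0 0 0 0 0 0 0 0 l 0).
  by apply: runs_straight; rewrite //= mod0n modn_small //; lia.
have R6 := @run_power A B.
have R7 : runs (Move rc rP) (frame 0 l P A B 0 0 0 0 0 0 0 0 0 0) 1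
    (frame 0 l P A B P 0 0 0 0 0 0 0 0 0) by apply: runs_straight.
have R8 := @run_candidates A B.
pose last_block := block [:: Sub rA rA rB; Const rt 1; Read rt rt; Sub rA rA rt;
  If rA (Const rfound 0) Skip].
pose L := frame (nat_of_bool f) l P A B 0 0 0 0 0 0 0 0 0 0.
exists (sem m (2 ^ w) last_block L); split.
  have R : runs acm_program (nseq 18 0) (1000 * (P * (l * (l * l))))
      (sem m (2 ^ w) last_block L).
    apply: runs_leq (runs_seq R1 (runs_seq R2 (runs_seq R3 (runs_seq R4 (runs_seq R5
      (runs_seq R6 (runs_seq R7 (runs_seq R8 (runs_straight (L' := _) _ erefl)))))))));
      last by [].
    (* The search costs [140 * (P * (l * (l * l)))] plus [P]; every other phase is also bounded by a
       multiple of [P * (l * (l * l))], and 1000 absorbs the sum. *)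
    have b1 (n : nat) : n <= l -> n * (l * 3 + 5).+1 <= 9 * (l * l) by nia.
    have b2 : P * (140 * (l * (l * l))).+1 = 140 * (P * (l * (l * l))) + P by lia.
    have b3 : l * l <= l * (l * l) by rewrite leq_pmull.
    have b4 : l <= l * l by rewrite leq_pmull.
    have b5 : l * (l * l) <= P * (l * (l * l)) by rewrite leq_pmull //; lia.
    have b6 : P <= P * (l * (l * l)) by rewrite leq_pmulr // !muln_gt0 l_gt0.
    have := b1 _ size_xs; have := b1 _ size_xs'; rewrite b2 /=.
    move: (l * l) (l * (l * l)) (size xs * _) (size xs' * _) (P * _) b3 b4 b5 b6
      => L2 L3 Y Y' X b3 b4 b5 b6; lia.
  move=> s rs ms; apply: R => // j; rewrite rs nth_nil nth_nseq.
  by case: ifP.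
rewrite /= mod0n modn_small; last lia.
rewrite -[A - B <= _]subn_eq0; case: (A - B - m 1 == 0); last by rewrite andbF.
by rewrite andbT eqb0 negbK.
Qed.

End Correctness.

(** * Memory layout and the final bound *)

Lemma encode_nth n (G : rel 'I_n) k xs xs' : let m := nth 0 (encode G k xs xs') in
  [/\ m 1 = k, m 2 = size xs, m 3 = size xs',
    forall i, i < size xs -> m (4 + i) = nth 0 xs i
    & forall i, i < size xs' -> m (4 + size xs + i) = nth 0 xs' i].
Proof.
split=> // i ilt.
  by rewrite -[LHS]/(nth 0 (xs ++ _) i) nth_cat ilt.
rewrite -[LHS]/(nth 0 (xs ++ xs' ++ _) (size xs + i)).
by rewrite nth_cat ltnNge leq_addr /= addKn nth_cat ilt.
Qed.

Theorem mainTheorem8 :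
  exists (P : cmd) (C c : nat),
  forall (n : nat) (G : rel 'I_n) (k l : nat) (X X' : {mset nat}%mset),
  acm_instance G l X X' ->
  forall (xs xs' : seq nat), seq_mset xs = X -> seq_mset xs' = X' ->
  forall w : nat,
  fits w (encode G k xs xs') -> C * (2 ^ l * n ^ c) <= 2 ^ w ->
  exists (t : nat) (s : state),
    [/\ exec w P (init (encode G k xs xs')) t s,
        t <= C * (2 ^ l * n ^ c) &
        accepts s <-> acm_yes G k X X'].
Proof.
(* The exponent 3 comes from the factor [l * (l * l)] together with [l <= n]. The same product
   bounds [2 ^ w] from below and so leaves enough room in the registers. *)
exists acm_program, 1000, 3 => n G k l X X' inst xs xs' EX EX' w _ hw; subst X X'.
have [[se _] /is_partition_seq[l0 x0 xl] /is_partition_seq[_ x0' xl'] val] := inst.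
have ln : l <= n by rewrite -xl' -[n]card_ord; exact: graph_valid_sumn val.
have l3 : l * (l * l) <= n ^ 3 by rewrite !expnS expn0 muln1 !leq_mul.
have bound : 1000 * (2 ^ l * (l * (l * l))) <= 1000 * (2 ^ l * n ^ 3).
  by rewrite leq_mul2l leq_mul2l l3 !orbT.
have word : 20 * (2 ^ l * l) <= 2 ^ w.
  apply: leq_trans (leq_trans bound hw); apply: leq_mul => //; apply: leq_mul => //.
  by rewrite leq_pmulr // muln_gt0 l0.
have [m1 m2 m3 mx mx'] := encode_nth G k xs xs'.
have sx : size xs <= l by rewrite -xl size_leq_sumn.
have sx' : size xs' <= l by rewrite -xl' size_leq_sumn.
have [L [R acc]] := run_acm_program xl xl' erefl sx sx' l0 word m2 m3 mx mx'.
have [|//|t [s [ex tb rs _]]] := R (init (encode G k xs xs')).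
  by move=> j; rewrite nth_nil.
exists t, s; split; [exact: ex | exact: leq_trans tb bound |].
rewrite (acm_yesP k inst) /accepts rs acc m1.
split=> [/andP[/hasP[c _ ac] ->]|[ref ->]].
  by split=> //; exact: accepting_refines ac.
rewrite andbT; have [c cl ac] := refines_accepting xl x0' ref.
by apply/hasP; exists c; rewrite // mem_iota.
Qed.
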